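(* Let $\varepsilon>0$. For every large enough (depending on $\varepsilon$) even nonnegative integer $n$, the perfect matching polytope of the complete graph $K^n$ has an extended formulation of size at most $2^{(1/2+\varepsilon)n}$.
   Context: $K^n$ is the complete graph on $\{1,\dots,n\}$. The perfect matching polytope of $K^n$ is the convex hull in $\mathbb{R}^{E(K^n)}$ of the characteristic vectors of the perfect matchings of $K^n$. An extended formulation of a polytope $P\subseteq\mathbb{R}^d$ is a description of a polyhedron $Q\subseteq\mathbb{R}^e$ by linear inequalities and equations, together with a linear map $\pi:\mathbb{R}^e\to\mathbb{R}^d$ with $\pi(Q)=P$; its size is the number of inequalities (equations and variables are not counted). *)

(* Defs.v *)
From HB Require Import structures.
From mathcomp Require Import all_boot all_order all_algebra.
From mathcomp Require Import all_classical all_reals all_analysis.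

Set Implicit Arguments.
Unset Strict Implicit.
Unset Printing Implicit Defensive.

Import Order.TTheory GRing.Theory Num.Theory.

Local Open Scope classical_set_scope.
Local Open Scope ring_scope.

Definition convex_hull (R : numDomainType) (V : lmodType R) (A : set V) :
    set V :=
  smallest (@convex_set R V) A.

Definition polyhedron (R : numDomainType) (e r q : nat)
    (A : 'M[R]_(r, e)) (b : 'cV[R]_r) (C : 'M[R]_(q, e)) (d : 'cV[R]_q) :
    set 'cV[R]_e :=
  [set x | (forall i, (A *m x) i 0 <= b i 0) /\ C *m x = d].

(* The size counts only the inequalities, i.e., the rows of ef_A: the equations
   (rows of ef_C) and the variables (ef_nvar) are free of charge. *)
Record extended_formulation (R : numDomainType) (V : lmodType R)
    (P : set V) := ExtendedFormulation {
  ef_nvar : nat;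
  ef_size : nat;
  ef_neq : nat;
  ef_A : 'M[R]_(ef_size, ef_nvar);
  ef_b : 'cV[R]_ef_size;
  ef_C : 'M[R]_(ef_neq, ef_nvar);
  ef_d : 'cV[R]_ef_neq;
  ef_proj : {linear 'cV[R]_ef_nvar -> V};
  ef_projE : ef_proj @` polyhedron ef_A ef_b ef_C ef_d = P
}.

Section CompleteGraph.
Variable n : nat.

Definition complete_edge : finType := {e : {set 'I_n} | #|e| == 2%N}.

Definition perfect_matching (M : {set complete_edge}) : bool :=
  [forall v : 'I_n, #|[set e in M | v \in val e]| == 1%N].

Variable R : numDomainType.

(* R^o is R as a module over itself; it makes the space of edge-indexed
   vectors an lmodType R. *)
Definition char_vector (M : {set complete_edge}) :
    {ffun complete_edge -> R^o} :=
  [ffun e => (e \in M)%:R].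

Definition perfect_matching_polytope : set {ffun complete_edge -> R^o} :=
  convex_hull [set char_vector M | M in [set M | perfect_matching M]].

End CompleteGraph.

Arguments perfect_matching_polytope n R : clear implicits.

(* Main.v *)
From HB Require Import structures.
Require Import Defs.
From mathcomp Require Import all_boot all_order all_algebra.
From mathcomp Require Import all_classical all_reals all_analysis.
From mathcomp Require Import zify ring.

(* A perfect matching [M] and a vertex set [S] are compatible when every edge
   of [M] has exactly one endpoint in [S]. Each [M] is compatible with at least
   [2 ^ (n/2)] of the [2 ^ n] vertex sets, so a greedy choice gives about
   [2 ^ (n/2) * n ^ 2] sets such that every [M] is compatible with one of them.
   The perfect matching polytope is then the convex hull of the union of the
   corresponding bipartite perfect matching polytopes, each of which is
   described by nonnegativity and degree equations (Birkhoff--von Neumann), and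
   Balas' disjunctive formulation of that hull has as many inequalities as there
   are pairs of a chosen set and an edge. *)

Set Implicit Arguments.
Unset Strict Implicit.
Unset Printing Implicit Defensive.

Import Order.TTheory GRing.Theory Num.Theory.

(** * Hall's marriage theorem *)

(* Rado's proof: in a minimal counterexample some [r x] has two elements; if
   neither can be deleted, the two violating sets contradict submodularity of
   [X |-> #|\bigcup_(x in X) r x|]. *)
Lemma Hall_marriage (T U : finType) (r : T -> {set U}) :
    (forall X : {set T}, #|X| <= #|\bigcup_(x in X) r x|) ->
  exists f : T -> U, injective f /\ forall x, f x \in r x.
Proof.
have [m] := ubnP (\sum_x #|r x|).
elim: m r => // m IH r lt_r hall.
have r_gt0 x : 0 < #|r x| by have := hall [set x]; rewrite big_set1 cards1.
have [/forallP r1 | /forallPn[x]] := boolP [forall x, #|r x| <= 1].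
  have /fin_all_exists[f fP] x : exists u, r x = [set u].
    by apply/cards1P; rewrite eqn_leq r1 r_gt0.
  exists f; split=> [x y fxy|x]; last by rewrite fP set11.
  have := hall [set x; y].
  by rewrite finset.bigcup_setU !big_set1 !fP fxy finset.setUid cards1 cards2; case: eqP.
rewrite -ltnNge => /card_gt1P [u1 [u2 [u1r u2r u12]]].
pose del u y := if y == x then r x :\ u else r y.
have delS u y : del u y \subset r y.
  by rewrite /del; case: eqP => [->|//]; apply: finset.subD1set.
suff [u ur hall_u] : exists2 u, u \in r x &
    forall X : {set T}, #|X| <= #|\bigcup_(y in X) del u y|.
  have [|f [f_inj fP]] := IH (del u) _ hall_u.
    rewrite -ltnS (leq_trans _ lt_r) // ltnS (bigD1 x) //= [leqRHS](bigD1 x) //=.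
    rewrite -addSn leq_add //; last by apply: leq_sum => y _; apply: subset_leq_card.
    by rewrite /del eqxx (cardsD1 u (r x)) ur.
  by exists f; split=> // y; apply: (fintype.subsetP (delS u y)).
have [/forallP|/forallPn[X1]] :=
  boolP [forall X : {set T}, #|X| <= #|\bigcup_(y in X) del u1 y|].
  by exists u1.
have [/forallP|/forallPn[X2]] :=
  boolP [forall X : {set T}, #|X| <= #|\bigcup_(y in X) del u2 y|].
  by exists u2.
pose N (X : {set T}) := \bigcup_(y in X) r y.
(* Only [r x] changes when [u] is deleted, so a violating set contains [x]; dropping [x] from it
   turns the strict inequality into a weak one. *)
have bad u (X : {set T}) : ~~ (#|X| <= #|\bigcup_(y in X) del u y|) ->
    #|N (X :\ x) :|: (r x :\ u)| <= #|X :\ x|.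
  rewrite -ltnNge => ltX.
  have xX : x \in X.
    apply: contraLR ltX => xX; rewrite -leqNgt (leq_trans (hall X)) //.
    rewrite subset_leq_card //; apply/finset.bigcupsP => y yX.
    apply: (finset.bigcup_max y) => //; rewrite /del; case: eqP => // yx.
    by rewrite -yx yX in xX.
  move: ltX; rewrite (cardsD1 x) xX ltnS; apply: leq_trans.
  rewrite subset_leq_card //; apply/finset.subUsetP; split.
    apply/finset.bigcupsP => y; rewrite !inE => /andP[yx yX].
    by apply: (finset.bigcup_max y) => //; rewrite /del (negPf yx).
  by apply: (finset.bigcup_max x) => //; rewrite /del eqxx.
move=> /bad; set Y2 := X2 :\ x => le2 /bad; set Y1 := X1 :\ x => le1.
set A1 := N Y1 :|: _ in le1; set A2 := N Y2 :|: _ in le2.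
(* As [u1] and [u2] differ, [A1 :|: A2] contains all of [r x]. The extra element [x] is the surplus
   of one that contradicts the sum of [le1] and [le2]. *)
have leU : #|x |: (Y1 :|: Y2)| <= #|A1 :|: A2|.
  apply: leq_trans (hall _) (subset_leq_card _).
  apply/finset.bigcupsP => y; rewrite in_setU1 => /orP[/eqP->|].
    apply/fintype.subsetP => u ur; rewrite !inE ur !andbT.
    have [->|_] := eqVneq u u1; last by rewrite orbT.
    by rewrite u12 !orbT.
  case/finset.setUP => yY; apply/fintype.subsetP => u ur; rewrite finset.in_setU; apply/orP.
    by left; rewrite inE; apply/orP; left; apply/finset.bigcupP; exists y.
  by right; rewrite inE; apply/orP; left; apply/finset.bigcupP; exists y.
have leI : #|Y1 :&: Y2| <= #|A1 :&: A2|.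
  apply: leq_trans (hall _) (subset_leq_card _).
  apply/finset.bigcupsP => y /finset.setIP[yY1 yY2]; rewrite finset.subsetI /A1 /A2 /N.
  by rewrite !finset.subsetU //= ?(finset.bigcup_sup y).
have := cardsUI A1 A2; have := cardsUI Y1 Y2.
move: leU; rewrite cardsU1 !inE eqxx /=; lia.
Qed.

(** * Greedy covering *)

(** Averaging: each [a] is related to at least a fraction [1 / m.+1] of [B], so some [b] is related
    to at least that fraction of [U]. *)
Lemma greedy_cover_step (A B : finType) (r : A -> B -> bool) (m : nat)
    (U : {set A}) :
    0 < #|B| -> (forall a, #|B| <= m.+1 * #|[set b | r a b]|) ->
  exists b, m.+1 * #|[set a in U | ~~ r a b]| <= m * #|U|.
Proof.
move=> B_gt0 rB.
suff /existsP[b bP] : [exists b, #|U| <= m.+1 * #|[set a in U | r a b]|].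
  exists b; have := finset.cardsID [set a | r a b] U.
  have -> : U :&: [set a | r a b] = [set a in U | r a b].
    by apply/setP => a; rewrite !inE.
  have -> : U :\: [set a | r a b] = [set a in U | ~~ r a b].
    by apply/setP => a; rewrite !inE andbC.
  move: bP; nia.
apply: contraT; rewrite negb_exists => /forallP ltU.
have : \sum_(b : B) (m.+1 * #|[set a in U | r a b]|).+1 <= \sum_(b : B) #|U|.
  by apply: leq_sum => b _; rewrite ltnNge.
rewrite sum_nat_const -(eq_bigr _ (fun b _ => addn1 _)) big_split /= sum1_card.
rewrite -big_distrr /=.
have -> : \sum_b #|[set a in U | r a b]| = \sum_(a in U) #|[set b | r a b]|.
  under eq_bigr do rewrite -sum1dep_card big_mkcondr.
  rewrite exchange_big; apply: eq_bigr => a _.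
  by rewrite -sum1dep_card [RHS]big_mkcond.
have : #|B| * #|U| <= m.+1 * \sum_(a in U) #|[set b | r a b]|.
  by rewrite mulnC -sum_nat_const big_distrr /=; apply: leq_sum => a _.
by rewrite (_ : #|xpredT| = #|B|); [lia | exact: eq_card].
Qed.

(** Each greedy choice shrinks the uncovered part by a factor [m / m.+1]; the bound is
    cross-multiplied to stay in [nat]. *)
Lemma greedy_cover (A B : finType) (r : A -> B -> bool) (m t : nat) :
    0 < #|B| -> (forall a, #|B| <= m.+1 * #|[set b | r a b]|) ->
  exists2 s : seq B, size s = t &
    m.+1 ^ t * #|[set a | ~~ has (r a) s]| <= m ^ t * #|A|.
Proof.
move=> B_gt0 rB; elim: t => [|t [s szs IH]].
  exists [::] => //=; rewrite !mul1n; exact: max_card.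
have [b bP] := greedy_cover_step [set a | ~~ has (r a) s] B_gt0 rB.
exists (b :: s); first by rewrite /= szs.
have -> : [set a | ~~ has (r a) (b :: s)]
          = [set a in [set a | ~~ has (r a) s] | ~~ r a b].
  by apply/setP => a; rewrite !inE /= negb_or andbC.
rewrite !expnS -mulnA mulnCA (leq_trans (leq_mul (leqnn _) bP)) //.
by rewrite mulnCA -mulnA leq_mul.
Qed.

(* Bernoulli: [(1 + 1/m)^(m+1) >= 2]. *)
Lemma double_expn_leq (m : nat) : 2 * m ^ m.+1 <= m.+1 ^ m.+1.
Proof.
suff bern k : m ^ k + k * m ^ k.-1 <= m.+1 ^ k.
  apply: leq_trans (bern m.+1); rewrite mul2n -addnn leq_add2l /=.
  by rewrite expnS leq_mul.
elim: k => [|[|k] IH] //=; first by rewrite !expn1 expn0; lia.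
rewrite [leqRHS]expnS; apply: leq_trans (leq_mul (leqnn _) IH).
rewrite /= !expnS; nia.
Qed.

(** Every [m.+1] choices at least halve the uncovered part, so [k.+1] such rounds bring at most
    [2 ^ k] elements below one. *)
Lemma covering_family (A B : finType) (r : A -> B -> bool) (m k : nat) :
    0 < #|B| -> #|A| <= 2 ^ k ->
    (forall a, #|B| <= m.+1 * #|[set b | r a b]|) ->
  exists2 s : seq B, size s = m.+1 * k.+1 & forall a, has (r a) s.
Proof.
move=> B_gt0 leA rB.
have [s szs sP] := greedy_cover (m.+1 * k.+1) B_gt0 rB.
exists s => // a0; apply: contraT => a0s.
have : 0 < #|[set a | ~~ has (r a) s]|.
  by apply/card_gt0P; exists a0; rewrite inE.
have : 2 ^ k.+1 * (m ^ m.+1) ^ k.+1 <= (m.+1 ^ m.+1) ^ k.+1.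
  by rewrite -expnMn leq_exp2r // double_expn_leq.
have : 0 < (m.+1 ^ m.+1) ^ k.+1 by rewrite !expn_gt0.
move: sP; rewrite !expnM (expnS 2); move: (_ ^ k.+1) ((m ^ _) ^ _) => x y.
move: #|_| => u sP x_gt0 le_yx u_gt0.
have : x <= y * 2 ^ k.
  by rewrite (leq_trans _ (leq_mul (leqnn y) leA)) // (leq_trans _ sP) // leq_pmulr.
by move: le_yx x_gt0; rewrite mulnAC -mulnA; lia.
Qed.

(** * Perfect matchings and the vertex sets they cross *)

Definition crosses (n : nat) (S : {set 'I_n}) (e : complete_edge n) : bool :=
  #|val e :&: S| == 1.

Lemma card_edge (n : nat) (e : complete_edge n) : #|val e| = 2.
Proof. exact/eqP/(valP e). Qed.

Lemma perfect_matching_deg (n : nat) (M : {set complete_edge n}) v :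
  perfect_matching M -> \sum_(e : complete_edge n | v \in val e) (e \in M) = 1.
Proof.
move=> pmM.
under eq_bigr do rewrite -[nat_of_bool _]/(if _ \in M then 1 else 0).
rewrite -big_mkcondr sum1dep_card; apply: etrans (eqP (forallP pmM v)).
by apply: eq_card => e; rewrite !inE andbC.
Qed.

Lemma perfect_matching_inj (n : nat) (M : {set complete_edge n}) v e f :
    perfect_matching M -> e \in M -> f \in M -> v \in val e -> v \in val f ->
  e = f.
Proof.
move=> /forallP/(_ v)/cards1P[g gP] eM fM ve vf.
have -> : e = g by apply/set1P; rewrite -gP inE eM.
by apply/esym/set1P; rewrite -gP inE fM.
Qed.

Lemma card_perfect_matching (n : nat) (M : {set complete_edge n}) :
  perfect_matching M -> #|M|.*2 = n.
Proof.
move=> pmM; rewrite -muln2 -sum_nat_const.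
transitivity (\sum_(e in M) \sum_(v in val e) 1).
  by apply: eq_bigr => e _; rewrite sum1_card card_edge.
under eq_bigr do rewrite big_mkcond.
rewrite exchange_big -[RHS]card_ord -sum1_card; apply: eq_bigr => v _.
rewrite -big_mkcondr sum1dep_card.
exact/eqP/(forallP pmM).
Qed.

(* Choosing independently for each edge of [M] which endpoint goes to [S]
   yields [2 ^ #|M|] distinct sets crossed by all of [M]. *)
Lemma num_crossed_sets (n : nat) (M : {set complete_edge n}) :
    perfect_matching M ->
  2 ^ n./2 <= #|[set S : {set 'I_n} | [forall e in M, crosses S e]]|.
Proof.
move=> pmM; rewrite -{1}(card_perfect_matching pmM) doubleK -card_powerset.
have /fin_all_exists[rep repP] (e : complete_edge n) : exists v, v \in val e.
  by apply/card_gt0P; rewrite card_edge.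
pose piece (T : {set complete_edge n}) e :=
  if e \in T then [set rep e] else val e :\ rep e.
pose side T := \bigcup_(e in M) piece T e.
have pieceS T e : piece T e \subset val e.
  by rewrite /piece; case: ifP; rewrite ?finset.sub1set ?repP ?finset.subD1set.
(* Distinct edges of [M] are disjoint, so the pieces of the other edges do not meet [e]; hence [T]
   can be read off from [side T]. *)
have sideI T e : e \in M -> val e :&: side T = piece T e.
  move=> eM; apply/eqP; rewrite finset.eqEsubset; apply/andP; split.
    apply/fintype.subsetP => v /finset.setIP[ve /finset.bigcupP[f fM vf]].
    suff -> : e = f by [].
    by apply: perfect_matching_inj pmM eM fM ve (fintype.subsetP (pieceS T f) v vf).
  by rewrite finset.subsetI pieceS (finset.bigcup_sup e).
have side_inj : {in powerset M &, injective side}.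
  suff mem_side T e : e \in M -> (rep e \in side T) = (e \in T).
    move=> T1 T2; rewrite !inE => T1M T2M eq_side; apply/setP => e.
    have [eM|eM] := boolP (e \in M); first by rewrite -(mem_side T1) // eq_side mem_side.
    rewrite (contraNF (fintype.subsetP T1M e) eM).
    by rewrite (contraNF (fintype.subsetP T2M e) eM).
  move=> eM; have := sideI T e eM; move=> /setP/(_ (rep e)).
  rewrite finset.in_setI repP /piece => /= ->.
  by case: ifP; rewrite !inE eqxx.
rewrite -(card_in_imset side_inj) subset_leq_card //.
apply/fintype.subsetP => _ /imsetP[T _ ->]; rewrite inE.
apply/forallP => e; apply/implyP => eM.
rewrite /crosses sideI // /piece; case: ifP; rewrite ?cards1 // => _.
by have := card_edge e; rewrite (cardsD1 (rep e)) repP => /eqP.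
Qed.

(** * A perfect matching in the support of a crossing weighting *)

Local Open Scope ring_scope.

Lemma sum_incident (R : nmodType) (n : nat) (X : {set 'I_n})
    (y : complete_edge n -> R) :
  \sum_(v in X) \sum_(e : complete_edge n | v \in val e) y e
  = \sum_(e : complete_edge n) y e *+ #|val e :&: X|.
Proof.
under eq_bigr do rewrite big_mkcond.
rewrite exchange_big; apply: eq_bigr => e _; rewrite -big_mkcondr.
by rewrite sumr_const; congr (_ *+ _); apply: eq_card => v; rewrite !inE andbC.
Qed.

(** Hall's condition holds in the support graph by weight: every edge of positive weight has at
    least as many endpoints in the neighbourhood of [X] as in [X], and all degrees equal
    [lambda]. *)
Lemma support_perfect_matching (R : realFieldType) (n : nat) (S : {set 'I_n})
    (y : complete_edge n -> R) (lambda : R) :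
    0 < lambda -> (forall e, 0 <= y e) ->
    (forall e, ~~ crosses S e -> y e = 0) ->
    (forall v, \sum_(e : complete_edge n | v \in val e) y e = lambda) ->
  exists2 M : {set complete_edge n}, perfect_matching M &
    forall e, e \in M -> 0 < y e.
Proof.
move=> lambda_gt0 y_ge0 y_cross y_deg.
pose joins e v w := [&& 0 < y e, v != w & val e == [set v; w]].
pose nbr v := [set w | [exists e, joins e v w]].
have [f [f_inj f_nbr]] : exists f, injective f /\ forall v, f v \in nbr v.
  apply: Hall_marriage => X; set N := \bigcup_(v in X) nbr v.
  suff: \sum_(v in X) lambda <= \sum_(w in N) lambda.
    by rewrite !sumr_const ler_pMn2l.
  rewrite -(eq_bigr _ (fun v _ => y_deg v)) -[leRHS](eq_bigr _ (fun v _ => y_deg v)).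
  rewrite !sum_incident; apply: ler_sum => e _.
  have [y_le0|y_gt0] := leP (y e) 0.
    by have -> : y e = 0; [apply/le_anti; rewrite y_le0 y_ge0 | rewrite !mul0rn].
  rewrite ler_pMn2l //.
  have /cards2P[a [b [ab eab]]] := valP e.
  have abN : a \in X -> b \in N.
    move=> aX; apply/finset.bigcupP; exists a => //; rewrite inE.
    by apply/existsP; exists e; rewrite /joins y_gt0 ab eab /=.
  have baN : b \in X -> a \in N.
    move=> bX; apply/finset.bigcupP; exists b => //; rewrite inE.
    by apply/existsP; exists e; rewrite /joins y_gt0 eq_sym ab eab finset.setUC /=.
  have cardI (Y : {set 'I_n}) : #|val e :&: Y| = ((a \in Y) + (b \in Y))%N.
    rewrite eab -sum1_card big_mkcond (bigD1 a) //= (bigD1 b) 1?eq_sym //= big1.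
      by rewrite !inE !eqxx orbT addn0; do 2 case: (_ \in Y).
    by move=> v /andP[va vb]; rewrite !inE (negPf va) (negPf vb).
  rewrite !cardI; case: (a \in X) abN => [->|_] //; last first.
    by case: (b \in X) baN => [->|_].
  by case: (b \in X) baN => [->|_] //; rewrite addn0 leq_addl.
(* Edges of positive weight cross [S], so [f] exchanges [S] and its complement. *)
have fS v : (f v \in S) = (v \notin S).
  have := f_nbr v; rewrite inE => /existsP[e /and3P[y_gt0 vf0 /eqP eE]].
  have : crosses S e by apply: contraLR y_gt0 => /y_cross ->; rewrite ltxx.
  rewrite /crosses eE => /cards1P[u /setP uE].
  have := uE v; have := uE (f v); rewrite !inE !eqxx orbT /= => -> ->.
  have := uE u; rewrite !inE eqxx => /andP[+ _].
  have [<-|vu] /= := eqVneq v u; first by move=> _; rewrite eq_sym (negPf vf0).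
  by move=> /eqP ->; rewrite eqxx.
(* Injectivity in both directions forces [S] and its complement to have equal size, so [f] maps [S]
   onto the complement. *)
have surj v : v \notin S -> exists2 u, u \in S & f u = v.
  have f_im : f @: S \subset ~: S.
    by apply/fintype.subsetP => _ /imsetP[u uS ->]; rewrite inE fS uS.
  have f_imC : f @: (~: S) \subset S.
    by apply/fintype.subsetP => _ /imsetP[u uS ->]; rewrite fS -finset.in_setC.
  have := subset_leq_card f_imC; rewrite card_imset // => leCS.
  have imE : f @: S = ~: S.
    by apply/eqP; rewrite eqEcard f_im card_imset.
  by rewrite -finset.in_setC -imE => /imsetP[u uS ->]; exists u.
(* [f] need not be an involution, so only its restriction to [S] supplies edges. *)
pose M := [set e : complete_edge n | [exists v in S, val e == [set v; f v]]].
have MP e : reflect (exists2 v, v \in S & val e = [set v; f v]) (e \in M).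
  rewrite inE; apply: (iffP exists_inP) => -[v vS /eqP]; exists v => //; exact/eqP.
exists M => [|e /MP[v _ eE]].
  apply/forallP => v.
  have [u [uS vu]] : exists u, u \in S /\ v \in [set u; f u].
    have [vS|/surj[u uS <-]] := boolP (v \in S); [exists v | exists u].
      by rewrite !inE eqxx.
    by rewrite !inE eqxx orbT.
  have := f_nbr u; rewrite inE => /existsP[e /and3P[_ _ /eqP eE]].
  apply/cards1P; exists e; apply/setP => g; rewrite [LHS]inE [RHS]inE.
  apply/andP/eqP => [[/MP[w wS gE] vg]|->]; last first.
    by split; [apply/MP; exists u | rewrite eE].
  apply/val_inj; rewrite gE eE; suff -> : w = u by [].
  move: vu vg; rewrite gE !inE => /orP[]/eqP -> /orP[]/eqP //.
  - by move=> uw; move: uS; rewrite uw fS wS.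
  - by move=> uw; move: wS; rewrite -uw fS uS.
  - by move/f_inj.
have := f_nbr v; rewrite inE => /existsP[g /and3P[y_gt0 _ /eqP gE]].
by rewrite (_ : e = g) //; apply/val_inj; rewrite eE gE.
Qed.

(** * Cones over convex sets and the Birkhoff--von Neumann decomposition *)

Local Open Scope classical_set_scope.
Local Open Scope ring_scope.

Lemma convex_comb_mem (R : realFieldType) (V : lmodType R) (C : set V) x y (a b : R) :
    @convex_set R V C -> C x -> C y -> 0 <= a -> 0 <= b -> a + b = 1 ->
  C (a *: x + b *: y).
Proof.
move=> cvxC Cx Cy a_ge0 b_ge0 ab1.
have a_le1 : a <= 1 by rewrite -ab1 lerDl.
have := cvxC x y (Itv01 a_ge0 a_le1) (mem_set Cx) (mem_set Cy).
rewrite inE -[b](addKr a) ab1 (addrC (- a)); exact.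
Qed.

(* The zero vector is listed apart because [C] may be empty. *)
Definition conic (R : realFieldType) (V : lmodType R) (C : set V) (s : R) (v : V) : Prop :=
  (s = 0 /\ v = 0) \/ (0 < s /\ exists2 c, C c & v = s *: c).

Lemma conicD (R : realFieldType) (V : lmodType R) (C : set V) s t v w :
    @convex_set R V C -> conic C s v -> conic C t w -> conic C (s + t) (v + w).
Proof.
move=> cvxC [[-> ->]|[s_gt0 [x Cx ->]]] Ctw; first by rewrite !add0r.
case: Ctw => [[-> ->]|[t_gt0 [y Cy ->]]].
  by rewrite !addr0; right; split=> //; exists x.
have st_gt0 : 0 < s + t by rewrite addr_gt0.
right; split=> //.
exists ((s / (s + t)) *: x + (t / (s + t)) *: y).
  apply: convex_comb_mem => //; rewrite ?divr_ge0 ?ltW //.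
  by rewrite -mulrDl divff ?gt_eqF.
by rewrite scalerDr !scalerA ![(s + t) * _]mulrC !divfK ?gt_eqF.
Qed.

Lemma conic_sum (R : realFieldType) (V : lmodType R) (C : set V) (I : finType)
    (s : I -> R) (v : I -> V) :
    @convex_set R V C -> (forall i, conic C (s i) (v i)) ->
  conic C (\sum_i s i) (\sum_i v i).
Proof.
move=> cvxC Csv; elim/big_ind2: _ => // [|s1 v1 s2 v2]; first by left.
exact: conicD.
Qed.

Lemma convex_hull_convex (R : numDomainType) (V : lmodType R) (A : set V) :
  @convex_set R V (convex_hull A).
Proof.
move=> x y l; rewrite !inE => Ax Ay B [cvxB AB].
have := cvxB x y l; rewrite !inE; apply; [exact: Ax | exact: Ay].
Qed.

(* Birkhoff--von Neumann for the bipartite graph of edges crossing [S]: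
   peel off a perfect matching of the support, scaled by its smallest weight. *)
Lemma crossing_conic (R : realFieldType) (n : nat) (S : {set 'I_n})
    (y : {ffun complete_edge n -> R^o}) (lambda : R) :
    (0 < n)%N -> (forall e, 0 <= y e) ->
    (forall e, ~~ crosses S e -> y e = 0) ->
    (forall v, \sum_(e : complete_edge n | v \in val e) y e = lambda) ->
  conic (perfect_matching_polytope n R) lambda y.
Proof.
move=> n_gt0; have [k] := ubnP #|[set e | y e != 0]|%SET.
elim: k y lambda => // k IH y lambda; rewrite ltnS => supp_le y_ge0 y_cross y_deg.
have lambda_ge0 : 0 <= lambda.
  by rewrite -(y_deg (Ordinal n_gt0)) sumr_ge0.
(* Each weight is at most the degree of an endpoint, so degree zero forces [y = 0]. *)
have [lambda_eq0|lambda_neq0] := eqVneq lambda 0.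
  left; split=> //; apply/ffunP => e; rewrite ffunE.
  have /card_gt0P[v ve] : (0 < #|val e|)%N by rewrite card_edge.
  apply/le_anti; rewrite y_ge0 andbT -lambda_eq0 -(y_deg v) (bigD1 e) //=.
  by rewrite lerDl sumr_ge0.
have lambda_gt0 : 0 < lambda by rewrite lt_def lambda_neq0.
have [M pmM M_supp] := support_perfect_matching lambda_gt0 y_ge0 y_cross y_deg.
have /forallP/(_ (Ordinal n_gt0))/cards1P[e0 /setP/(_ e0)] := pmM.
rewrite !inE eqxx => /andP[e0M _].
have [e1 e1M e1_min] : exists2 e1, e1 \in M & forall e, e \in M -> y e1 <= y e.
  by case: (arg_minP y e0M) => e1 e1M e1_min; exists e1.
pose t := y e1; have t_gt0 : 0 < t by apply: M_supp.
have charM : perfect_matching_polytope n R (char_vector R M).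
  by apply: sub_gen_smallest; exists M.
(* Degree and weights split into [t] times the matching and a remainder. The support of the
   remainder is smaller: [e1] leaves it and, as [M] lies in the old support, no edge enters. *)
rewrite -(subrKC t lambda) -(subrKC (t *: char_vector R M) y).
apply: conicD; first exact: convex_hull_convex.
  by right; split=> //; exists (char_vector R M).
have zE e : (y - t *: char_vector R M) e = y e - t * (e \in M)%:R.
  by rewrite !ffunE.
apply: IH => [|e|e /y_cross ye0|v].
- apply: leq_trans supp_le; apply: proper_card; apply/properP; split.
    apply/fintype.subsetP => e; rewrite !inE zE; apply: contraNneq => ye0.
    have eM : e \notin M by apply/negP => /M_supp; rewrite ye0 ltxx.
    by rewrite ye0 (negPf eM) mulr0 subrr.
  exists e1; first by rewrite inE gt_eqF.
  by rewrite inE zE e1M mulr1 subrr eqxx.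
- rewrite zE subr_ge0; case: (boolP (e \in M)) => [/e1_min|_].
    by rewrite mulr1.
  by rewrite mulr0.
- rewrite zE ye0; have eM : e \notin M by apply/negP => /M_supp; rewrite ye0 ltxx.
  by rewrite (negPf eM) mulr0 subrr.
under eq_bigr do rewrite zE.
rewrite sumrB y_deg -big_distrr /= -natr_sum.
by rewrite perfect_matching_deg // mulr1.
Qed.

(** * Balas' disjunctive formulation *)

Definition lincomb (R : realFieldType) (V : lmodType R) (I : finType)
    (g : I -> V) (x : 'cV[R]_#|I|) : V :=
  \sum_i x (enum_rank i) 0 *: g i.

Lemma lincomb_is_linear (R : realFieldType) (V : lmodType R) (I : finType)
    (g : I -> V) : linear (lincomb g).
Proof.
move=> a x y; rewrite /lincomb scaler_sumr -big_split /=; apply: eq_bigr => i _.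
by rewrite !mxE scalerDl scalerA.
Qed.

HB.instance Definition _ (R : realFieldType) (V : lmodType R) (I : finType)
    (g : I -> V) :=
  GRing.isLinear.Build R 'cV[R]_#|I| V *:%R (lincomb g) (lincomb_is_linear g).

(** Allows variables and equations to be indexed by arbitrary finite types. Nonnegativity gives the
    only inequalities, one per variable. *)
Lemma extended_formulation_of_functions (R : realFieldType) (V : lmodType R)
    (P : set V) (I J : finType) (c : J -> I -> R) (d : J -> R) (g : I -> V) :
    [set \sum_i x i *: g i | x in
      [set x : I -> R | (forall i, 0 <= x i) /\
                        forall j, \sum_i c j i * x i = d j]] = P ->
  exists F : extended_formulation P, ef_size F = #|I|.
Proof.
move=> defP.
pose C : 'M[R]_(#|J|, #|I|) := \matrix_(j, i) c (enum_val j) (enum_val i).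
pose D : 'cV[R]_#|J| := \col_j d (enum_val j).
pose A : 'M[R]_#|I| := - 1%:M.
suff projE : lincomb g @` polyhedron A 0 C D = P.
  by exists (@ExtendedFormulation R V P _ _ _ A 0 C D (lincomb g) projE).
have rowC x j : (C *m x) j 0 = \sum_i c (enum_val j) i * x (enum_rank i) 0.
  rewrite mxE (reindex (@enum_rank I)) /=; last exact/onW_bij/enum_rank_bij.
  by apply: eq_bigr => i _; rewrite mxE enum_rankK.
have rowA x i : (A *m x) i 0 = - x i 0 by rewrite mulNmx mul1mx mxE.
rewrite -defP; apply/seteqP; split=> [_ [x [x_ge0 xC] <-]|_ [x [x_ge0 xC] <-]].
  exists (fun i => x (enum_rank i) 0) => //; split=> [i|j].
    by have := x_ge0 (enum_rank i); rewrite rowA mxE oppr_le0.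
  have /matrixP/(_ (enum_rank j) 0) := xC.
  by rewrite rowC !mxE enum_rankK.
exists (\col_i x (enum_val i)); last first.
  by apply: eq_bigr => i _; rewrite mxE enum_rankK.
split=> [i|]; first by rewrite rowA !mxE oppr_le0.
apply/colP => j; rewrite rowC mxE -xC; apply: eq_bigr => i _.
by rewrite mxE enum_rankK.
Qed.

Lemma sum_pair (V : nmodType) (I E : finType) (F : I * E -> V) :
  \sum_p F p = \sum_i \sum_e F (i, e).
Proof. by rewrite pair_bigA /=; apply: eq_bigr => -[]. Qed.

Lemma sum_slice (R : pzRingType) (I E : finType) (i : I) (h : E -> R) (x : I * E -> R) :
  \sum_p (if p.1 == i then h p.2 else 0) * x p = \sum_e h e * x (i, e).
Proof.
rewrite sum_pair /=.
rewrite (bigD1 i) //= [X in _ + X]big1 ?addr0 => [|j /negPf ji].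
  by apply: eq_bigr => e _; rewrite eqxx.
by rewrite big1 // => e _; rewrite ji mul0r.
Qed.

Lemma sum_indic (R : pzRingType) (E : finType) (P : pred E) (x : E -> R) :
  \sum_e (P e)%:R * x e = \sum_(e | P e) x e.
Proof.
by rewrite [RHS]big_mkcond; apply: eq_bigr => e _; rewrite mulr_natl mulrb.
Qed.

(* Balas' formulation of the convex hull of the union of the bipartite perfect
   matching polytopes of the graphs of edges crossing [S i]; the [i]-th copy of
   the variables is scaled by its degree, the convex multiplier. *)
Lemma crossing_cover_formulation (R : realFieldType) (n : nat) (I : finType)
    (S : I -> {set 'I_n}) :
    (0 < n)%N ->
    (forall M : {set complete_edge n}, perfect_matching M ->
      exists i, forall e, e \in M -> crosses (S i) e) ->
  exists F : extended_formulation (perfect_matching_polytope n R),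
    ef_size F = (#|I| * #|complete_edge n|)%N.
Proof.
move=> n_gt0 cover; pose v0 := Ordinal n_gt0.
(* Three kinds of equations: in copy [i], edges not crossing [S i] get weight zero; in copy [i], all
   degrees agree with that at [v0]; the degrees at [v0] sum to 1 over the copies. The degree at [v0]
   thus serves as the convex multiplier, without a variable of its own. *)
pose c (j : I * complete_edge n + I * 'I_n + unit) (p : I * complete_edge n) : R :=
  match j with
  | inl (inl (i, e)) =>
      if p.1 == i then ((p.2 == e) && ~~ crosses (S i) e)%:R else 0
  | inl (inr (i, v)) =>
      if p.1 == i then (v \in val p.2)%:R - (v0 \in val p.2)%:R else 0
  | inr _ => (v0 \in val p.2)%:R
  end.
pose d (j : I * complete_edge n + I * 'I_n + unit) : R :=
  if j is inr _ then 1 else 0.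
pose g (p : I * complete_edge n) : {ffun complete_edge n -> R^o} :=
  [ffun e => (e == p.2)%:R].
pose deg (x : I * complete_edge n -> R) i v :=
  \sum_(e : complete_edge n | v \in val e) x (i, e).
have cE x : (forall j, \sum_p c j p * x p = d j) <->
    [/\ forall i e, ~~ crosses (S i) e -> x (i, e) = 0,
        forall i v, deg x i v = deg x i v0 & \sum_i deg x i v0 = 1].
  have c1 i e : \sum_p c (inl (inl (i, e))) p * x p
      = (~~ crosses (S i) e)%:R * x (i, e).
    rewrite (sum_slice i (fun e' => ((e' == e) && ~~ crosses (S i) e)%:R)).
    rewrite (bigD1 e) //= eqxx big1 ?addr0 // => f /negPf ->.
    by rewrite mul0r.
  have c2 i v : \sum_p c (inl (inr (i, v))) p * x p = deg x i v - deg x i v0.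
    rewrite (sum_slice i (fun e : complete_edge n =>
      (v \in val e)%:R - (v0 \in val e)%:R)).
    under eq_bigr do rewrite mulrBl.
    by rewrite sumrB !(sum_indic _ (fun e => x (i, e))).
  have c3 : \sum_p c (inr tt) p * x p = \sum_i deg x i v0.
    rewrite sum_pair /=.
    by apply: eq_bigr => i _; rewrite (sum_indic _ (fun e => x (i, e))).
  split=> [eqs|[eq1 eq2 eq3] [[[i e]|[i v]]|[]]].
  - split=> [i e nc|i v|]; last by rewrite -c3 eqs.
      by have := eqs (inl (inl (i, e))); rewrite c1 nc mul1r.
    by have := eqs (inl (inr (i, v))); rewrite c2 => /subr0_eq.
  - rewrite c1; case: (boolP (crosses _ _)) => [_|/eq1 ->]; first by rewrite mul0r.
    by rewrite mulr0.
  - by rewrite c2 eq2 subrr.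
  - by rewrite c3 eq3.
have gE (x : I * complete_edge n -> R) : \sum_p x p *: g p
    = \sum_i [ffun e => x (i, e) : R^o].
  rewrite sum_pair /=.
  apply: eq_bigr => i _; apply/ffunP => e; rewrite sum_ffunE ffunE.
  under eq_bigr do rewrite !ffunE.
  rewrite (bigD1 e) //= eqxx big1 => [|f /negPf fe]; first by rewrite addr0; apply: mulr1.
  by rewrite eq_sym fe; apply: mulr0.
rewrite -card_prod.
apply: (extended_formulation_of_functions (c := c) (d := d) (g := g)).
apply/seteqP; split=> [_ [x [x_ge0 /cE[x_cross x_deg x_sum]] <-]|].
  rewrite gE.
  (* Each copy lies in the cone over the polytope at height its degree, and these heights sum to
     1. *)
  suff [[/eqP]|[_ [y Py ->]]] : conic (perfect_matching_polytope n R) 1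
      (\sum_i [ffun e => x (i, e) : R^o]).
  - by rewrite oner_eq0.
  - by rewrite scale1r.
  rewrite -x_sum; apply: conic_sum => [|i]; first exact: convex_hull_convex.
  apply: (crossing_conic (S := S i)) => // [e|e|v]; rewrite ?ffunE //.
    exact: x_cross.
  by rewrite -(x_deg i v); apply: eq_bigr => e _; rewrite ffunE.
(* For the converse, the projection is shown to be convex and to contain all characteristic
   vectors. *)
apply: smallest_sub => [u w l|_ [M pmM <-]].
  rewrite !inE => -[x [x_ge0 /cE[x_cross x_deg x_sum]] <-].
  move=> [y [y_ge0 /cE[y_cross y_deg y_sum]] <-].
  have l_ge0 : 0 <= l%:num by [].
  have l_le1 : 0 <= 1 - l%:num by rewrite subr_ge0.
  pose z p := l%:num * x p + (1 - l%:num) * y p.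
  have zdeg i v : deg z i v = l%:num * deg x i v + (1 - l%:num) * deg y i v.
    by rewrite /deg big_split /= -!big_distrr.
  exists z.
    split=> [p|]; first by rewrite addr_ge0 ?mulr_ge0.
    apply/cE; split=> [i e nc|i v|].
    - by rewrite /z x_cross // y_cross // !mulr0 addr0.
    - by rewrite !zdeg x_deg y_deg.
    - under eq_bigr do rewrite zdeg.
      by rewrite big_split /= -!big_distrr /= x_sum y_sum !mulr1 subrKC.
  under eq_bigr do rewrite scalerDl -!scalerA.
  by rewrite big_split /= -!scaler_sumr.
have [i iM] := cover M pmM.
(* All the weight goes to one copy whose set is crossed by all of [M]. *)
pose x (p : I * complete_edge n) : R := ((p.1 == i) && (p.2 \in M))%:R.
have xdeg j v : deg x j v = (j == i)%:R.
  rewrite /deg /x /=; case: (j == i) => /=; last by rewrite big1.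
  by rewrite -natr_sum perfect_matching_deg.
exists x.
  split=> [p|]; first by rewrite ler0n.
  apply/cE; split=> [j e|j v|].
  - rewrite /x /=; case: eqP => //= ->; apply: contraNeq.
    by rewrite pnatr_eq0 eqb0 negbK => /iM.
  - by rewrite !xdeg.
  under eq_bigr do rewrite xdeg.
  by rewrite (bigD1 i) //= eqxx big1 ?addr0 // => j /negPf ->.
rewrite gE; apply/ffunP => e; rewrite sum_ffunE ffunE.
rewrite (bigD1 i) //= !ffunE /x /= eqxx big1 ?addr0 // => j /negPf ji.
by rewrite ffunE ji.
Qed.

(** * Counting and the asymptotic bound *)

Lemma card_complete_edge (n : nat) : #|complete_edge n| = 'C(n, 2).
Proof.
rewrite -[X in 'C(X, _)]card_ord -card_draws card_sig -cardsE.
by apply: eq_card => e; rewrite !inE.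
Qed.

Lemma small_crossing_cover (n : nat) : ~~ odd n -> (0 < n)%N ->
  exists2 s : seq {set 'I_n}, (size s <= 2 ^ n./2 * n ^ 2)%N &
    forall M : {set complete_edge n}, perfect_matching M ->
      exists2 S, S \in s & forall e, e \in M -> crosses S e.
Proof.
move=> n_even n_gt0.
(* The implication relates edge sets that are not perfect matchings to every [S], so the covering
   lemma can range over all edge sets. *)
pose r (M : {set complete_edge n}) (S : {set 'I_n}) :=
  perfect_matching M ==> [forall e in M, crosses S e].
have card_setT (T : finType) : #|{set T}| = (2 ^ #|T|)%N.
  by rewrite -[#|T|]cardsT -card_powerset powersetT cardsT.
have pow_gt0 : (0 < 2 ^ n./2)%N by rewrite expn_gt0.
have [||M|s szs sP] := @covering_family _ _ r (2 ^ n./2).-1 #|complete_edge n|.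
- by rewrite card_setT expn_gt0.
- by rewrite card_setT.
- rewrite prednK // /r; case: (boolP (perfect_matching M)) => /= [pmM|_].
    rewrite card_setT card_ord -{1}(even_halfK n_even) -addnn expnD.
    by rewrite leq_mul2l num_crossed_sets ?orbT.
  by rewrite -cardsT leq_pmull.
exists s.
  rewrite szs prednK // leq_mul2l card_complete_edge; apply/orP; right.
  by rewrite bin2 -divn2; case: n n_gt0 {r s szs sP pow_gt0 n_even} => // n _; nia.
move=> M pmM; have /hasP[S Ss] := sP M.
by rewrite /r pmM => /forallP SM; exists S => // e; apply/implyP.
Qed.

Lemma powR_ge_poly (R : realType) (eps : R) : 0 < eps ->
  exists N : nat, forall n : nat, (N <= n)%N ->
    n%:R ^+ 4 <= 2 `^ (eps * n%:R).
Proof.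
move=> eps_gt0.
pose c := eps * ln 2 / 5.
have c_gt0 : 0 < c by rewrite divr_gt0 // mulr_gt0 // ln_gt0 // ltr1n.
exists (Num.truncn (c ^- 5)).+1 => n leN.
have cn : 1 <= c ^+ 5 * n%:R.
  rewrite -ler_pdivrMl ?exprn_gt0 // mulr1 (le_trans (ltW (truncnS_gt _))) //.
  by rewrite ler_nat.
rewrite /powR pnatr_eq0 /=.
have -> : eps * n%:R * ln 2 = c * n%:R *+ 5 by rewrite /c -mulr_natr; field.
rewrite -[_ *+ 5]mulr_natl expRM_natl.
have le1 : c * n%:R <= expR (c * n%:R).
  by rewrite (le_trans _ (expR_ge1Dx _)) // lerDr.
apply: (@le_trans _ _ ((c * n%:R) ^+ 5)).
  by rewrite exprMn [n%:R ^+ 5]exprS mulrA ler_peMl // exprn_ge0.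
by rewrite lerXn2r // nnegrE ?expR_ge0 // mulr_ge0 // ltW.
Qed.

Theorem proposition3 (R : realType) (eps : R) (eps_gt0 : 0 < eps) :
  exists N : nat, forall n : nat, (N <= n)%N -> ~~ odd n ->
    exists F : extended_formulation (perfect_matching_polytope n R),
      (ef_size F)%:R <= 2 `^ ((2^-1 + eps) * n%:R).
Proof.
have [N polyN] := powR_ge_poly eps_gt0.
exists N.+1 => n ltNn n_even; have n_gt0 : (0 < n)%N by apply: leq_trans ltNn.
have [s s_size s_cover] := small_crossing_cover n_even n_gt0.
have [M pmM|F FE] := @crossing_cover_formulation R n 'I_(size s) (nth finset.set0 s) n_gt0.
  have [S Ss SM] := s_cover M pmM.
  have ltSs : (index S s < size s)%N by rewrite index_mem.
  by exists (Ordinal ltSs); rewrite /= nth_index.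
exists F; rewrite FE card_ord mulrDl powRD ?pnatr_eq0 ?implybT //.
(* One factor [n ^ 2] comes from the size of the cover, the other bounds the number of edges. *)
apply: (@le_trans _ _ ((2 ^ n./2 * n ^ 4)%N%:R)).
  rewrite ler_nat (leq_trans (leq_mul s_size (leqnn _))) // -mulnA leq_mul //.
  rewrite card_complete_edge -[(n ^ 4)%N]/(n ^ (2 + 2))%N expnD leq_mul // bin2.
  by rewrite (leq_trans (half_leq (leq_mul (leqnn _) (leq_pred n)))) // -divn2 leq_div.
rewrite natrM !natrX ler_pM ?exprn_ge0 ?polyN // 1?ltnW //.
rewrite -{2}(even_halfK n_even) -mul2n natrM mulKf ?pnatr_eq0 //.
by rewrite powR_mulrn.
Qed.
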